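(* If there exists a nonempty open interval of $(1,+\infty)$ which does not contain any Salem number, then the Conjecture of Lehmer for Salem numbers is true, i.e. there exists a real number $c > 1$ such that every Salem number $\theta$ satisfies $\theta \geq c$.
   Context: A Salem number is a real algebraic integer $\theta>1$ all of whose other Galois conjugates have modulus $\leq 1$, at least one of them having modulus $1$. The Conjecture of Lehmer for Salem numbers is the assertion that $1$ is not a limit point of the set of Salem numbers. *)

(* Defs.v *)
From mathcomp Require Import all_boot all_order all_algebra.
From mathcomp Require Import all_classical all_reals all_analysis.
From mathcomp Require Import complex.

Set Implicit Arguments.
Unset Strict Implicit.
Unset Printing Implicit Defensive.

Import Order.TTheory GRing.Theory Num.Theory.
Import numFieldNormedType.Exports.

Local Open Scope classical_set_scope.
Local Open Scope ring_scope.
Local Open Scope complex_scope.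

Definition algebraic_integer (K : nzRingType) (x : K) : Prop :=
  integralOver (intr : int -> K) x.

Definition is_minpoly (K : fieldType) (x : K) (p : {poly rat}) : Prop :=
  [/\ p \is monic, irreducible_poly p & root (map_poly ratr p) x].

(* Galois conjugates over the rationals, x itself included; no number is a
   conjugate of a transcendental x. *)
Definition galois_conjugate (K : fieldType) (x z : K) : Prop :=
  exists2 p : {poly rat}, is_minpoly x p & root (map_poly ratr p) z.

(* The norm `|z| on R[i] is the usual modulus, injected into R[i]; the order
   of R[i] restricts to that of R on real elements. *)
Definition salem (R : realType) (theta : R) : Prop :=
  [/\ algebraic_integer theta,
      1 < theta,
      (forall z : R[i], galois_conjugate theta%:C z -> z != theta%:C ->
         `|z| <= 1) &
      exists z : R[i],
        [/\ galois_conjugate theta%:C z, z != theta%:C & `|z| = 1]].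

Definition salem_numbers (R : realType) : set R := [set theta | salem theta].
Arguments salem_numbers : clear implicits.

Definition lehmer_conjecture_salem (R : realType) : Prop :=
  ~ limit_point (salem_numbers R) (1 : R).

(* Main.v *)
Require Import Defs.
From mathcomp Require Import all_boot all_order all_algebra.
From mathcomp Require Import all_classical all_reals all_analysis.
From mathcomp Require Import complex.

Set Implicit Arguments.
Unset Strict Implicit.
Unset Printing Implicit Defensive.

Import Order.TTheory GRing.Theory Num.Theory.
Import numFieldNormedType.Exports.

Local Open Scope classical_set_scope.
Local Open Scope ring_scope.

(** Every power of a Salem number is again a Salem number ([salem_exp]). Choose
[1 < a < b] such that everything strictly between [a] and [b] lies in the given
interval. If some Salem number [theta] were less than [b / a], then the first
power of [theta] exceeding [a] would be at most [a * theta < b]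
([exists_exp_between]): a Salem number in the interval. So [b / a] bounds all
Salem numbers from below, and [1] is not a limit point.

That powers of Salem numbers are Salem numbers rests on the fact that the
conjugates of [x ^+ k] are exactly the [y ^+ k] with [y] a conjugate of [x]:
taking powers preserves moduli equal to [1] and moduli at most [1].  Let [p] and
[q] be the minimal polynomials of [x] and [x ^+ k].  Each [y ^+ k] is a conjugate
because [p] divides [q] composed with ['X^k] ([conjugate_exp]).  There are no
others ([conjugate_exp_inv]): let [A] be the companion matrix of [p].  The
characteristic polynomial of [A ^+ k] has rational coefficients and vanishes at
[x ^+ k], so [q] divides it; and over an algebraically closed field the
eigenvalues of [A ^+ k] are the [k]-th powers of those of [A]
([eigenvalue_exp], [eigenvalue_exp_inv]). *)

(** * Irreducible polynomials vanishing at a point of an extension *)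

(** Otherwise [p] and [q] would be coprime, and coprimality persists in the
extension, where it excludes common roots. *)
Lemma irreducible_root_dvdp (F K : fieldType) (f : {rmorphism F -> K})
    (p q : {poly F}) (x : K) :
  irreducible_poly p -> root (map_poly f p) x -> root (map_poly f q) x ->
  p %| q.
Proof.
move=> irr_p px qx; apply: contraTT isT => npq.
have : coprimep (map_poly f p) (map_poly f q).
  by rewrite coprimep_map irreducible_poly_coprime.
by move=> /coprimep_root /(_ px); rewrite -rootE qx.
Qed.

(** A nonzero polynomial of least size among those vanishing at [x] is
irreducible. *)
Lemma exists_irreducible_root (F K : fieldType) (f : {rmorphism F -> K})
    (p : {poly F}) (x : K) :
  p != 0 -> root (map_poly f p) x ->
  exists q : {poly F},
    [/\ q \is monic, irreducible_poly q & root (map_poly f q) x].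
Proof.
move=> p0 px.
pose P n := `[< exists q : {poly F},
                [/\ q != 0, root (map_poly f q) x & size q = n] >].
have exP : exists n, P n by exists (size p); apply/asboolP; exists p.
case: (ex_minnP exP) => n /asboolP [q [q0 qx szq]] minn.
have minq d : d != 0 -> root (map_poly f d) x -> (size q <= size d)%N.
  by move=> d0 dx; rewrite szq; apply/minn/asboolP; exists d.
have lq0 : (lead_coef q)^-1 != 0 by rewrite invr_eq0 lead_coef_eq0.
exists ((lead_coef q)^-1 *: q); split.
- by rewrite monicE lead_coefZ mulVf ?lead_coef_eq0.
- have irr_q : irreducible_poly q.
    split.
      rewrite ltnNge; apply/negP => /size1_polyC qc.
      move: qx q0; rewrite qc map_polyC /= rootC fmorph_eq0 => /eqP ->.
      by rewrite polyC0 eqxx.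
    move=> d d1 dq.
    have [e eq_q] := dvdpP _ _ dq.
    have d0 : d != 0 by apply: contraNneq q0 => d0; rewrite eq_q d0 mulr0.
    have e0 : e != 0 by apply: contraNneq q0 => e0; rewrite eq_q e0 mul0r.
    have : root (map_poly f e) x || root (map_poly f d) x.
      by rewrite -rootM -rmorphM -eq_q.
    case/orP => [ex|dx].
      (* a cofactor as large as [q] leaves only a constant [d] *)
      have := minq e e0 ex; rewrite {1}eq_q size_mul //.
      have: (size d != 0)%N by rewrite size_poly_eq0.
      case: (size d) d1 => [|[|m]] // _ _.
      by rewrite !addnS /= ltnNge leq_addr.
    by rewrite -dvdp_size_eqp // eqn_leq dvdp_leq //= minq.
  split; first by rewrite size_scale ?irr_q.1.
  move=> d d1; rewrite dvdpZr // => dq.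
  by apply: eqp_trans (irr_q.2 d d1 dq) _; rewrite eqp_sym eqp_scale.
- by rewrite map_polyZ rootZ ?fmorph_eq0.
Qed.

(** * Eigenvalues of powers of a matrix *)

Lemma eigenvalue_exp (F : fieldType) (n : nat) (A : 'M[F]_n.+1) (a : F)
    (k : nat) :
  eigenvalue A a -> eigenvalue (A ^+ k) (a ^+ k).
Proof.
case/eigenvalueP => v vA v0; apply/eigenvalueP; exists v => //.
elim: k => [|k IHk]; first by rewrite !expr0 mulmx1 scale1r.
by rewrite !exprS -mulmxE mulmxA vA -scalemxAl IHk scalerA.
Qed.

(** Splitting ['X^k - z] into the factors ['X - w] turns [A ^+ k - z] into a
product of matrices [A - w], one of which is singular if the product is. *)
Lemma eigenvalue_exp_inv (F : closedFieldType) (n : nat) (A : 'M[F]_n.+1)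
    (z : F) (k : nat) :
  (0 < k)%N -> eigenvalue (A ^+ k) z ->
  exists2 w, eigenvalue A w & w ^+ k = z.
Proof.
move=> k0 ev.
have [r] := closed_field_poly_normal ('X^k - z%:P).
rewrite lead_coefXnsubC // scale1r => fact.
have singular (B : 'M[F]_n.+1) a : eigenvalue B a = (\det (B - a%:M) == 0).
  by rewrite /eigenvalue /eigenspace kermx_eq0 row_free_unit unitmxE unitfE negbK.
have : \det (horner_mx A (\prod_(w <- r) ('X - w%:P))) == 0.
  by rewrite -fact rmorphB /= horner_mx_C rmorphXn /= horner_mx_X -singular.
have : all (root ('X^k - z%:P)) r.
  by apply/allP => w wr; rewrite fact root_prod_XsubC.
elim: r {fact} => [|w r IHr] /=.
  by rewrite big_nil rmorph1 det1 oner_eq0.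
case/andP => wz rz.
rewrite big_cons rmorphM -mulmxE det_mulmx mulf_eq0 => /orP [|/IHr]; last exact.
rewrite rmorphB /= horner_mx_C horner_mx_X -singular => Aw.
by exists w => //; move: wz; rewrite rootE !hornerE subr_eq0 => /eqP.
Qed.

(** * Conjugates of a power *)

Lemma exists_char_poly (F : comNzRingType) (p : {poly F}) :
  p \is monic -> (1 < size p)%N ->
  exists n, exists A : 'M[F]_n.+1, char_poly A = p.
Proof.
move=> mon_p sz_p; have := companionmxK mon_p.
move: (companionmx p); case: (size p) sz_p => [|[|n]] //= _ A chA.
by exists n, A.
Qed.

(** With [A] the companion matrix of [p], the characteristic polynomial of
[A ^+ k] is the polynomial whose roots are the [k]-th powers of the roots of
[p]. Taking a matrix puts its coefficients in [F] without an appeal to symmetric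
functions of the roots. *)
Lemma exists_poly_roots_exp (F : fieldType) (K : closedFieldType)
    (f : {rmorphism F -> K}) (p : {poly F}) (k : nat) :
  p \is monic -> (1 < size p)%N -> (0 < k)%N ->
  exists2 c : {poly F}, c \is monic &
    forall z, root (map_poly f c) z <->
      exists2 w, root (map_poly f p) w & w ^+ k = z.
Proof.
move=> mon_p sz_p k0.
have [n [A chA]] := exists_char_poly mon_p sz_p.
exists (char_poly (A ^+ k)); first exact: char_poly_monic.
move=> z; rewrite -chA !map_char_poly (rmorphXn (map_mx f)) -eigenvalue_root_char.
split=> [/(eigenvalue_exp_inv k0) [w Aw wz]|[w]].
  by exists w; rewrite // -eigenvalue_root_char.
by rewrite -eigenvalue_root_char => Aw <-; apply: eigenvalue_exp.
Qed.

Local Notation toC C := (ratr : {rmorphism rat -> C}).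

Lemma is_minpoly_exp (C : numClosedFieldType) (x : C) (p : {poly rat})
    (k : nat) :
  (0 < k)%N -> is_minpoly x p -> exists q, is_minpoly (x ^+ k) q.
Proof.
move=> k0 [mon_p irr_p px].
have [c mon_c croot] := exists_poly_roots_exp (toC C) mon_p irr_p.1 k0.
have cx : root (map_poly (toC C) c) (x ^+ k) by apply/croot; exists x.
have [q [mon_q irr_q qx]] := exists_irreducible_root (monic_neq0 mon_c) cx.
by exists q; split.
Qed.

(** If [q] is the minimal polynomial of [x ^+ k], then [q] composed with ['X^k]
vanishes at [x], hence at each conjugate [z] of [x]. *)
Lemma conjugate_exp (C : numClosedFieldType) (x z : C) (k : nat) :
  (0 < k)%N -> galois_conjugate x z -> galois_conjugate (x ^+ k) (z ^+ k).
Proof.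
move=> k0 [p min_p pz]; have [q min_q] := is_minpoly_exp k0 min_p.
exists q => //; case: min_p min_q => _ irr_p px [_ _ qx].
have root_expE y : root (map_poly ratr (q \Po 'X^k)) y
                 = root (map_poly (toC C) q) (y ^+ k).
  by rewrite map_comp_poly map_polyXn root_comp hornerXn.
rewrite -root_expE; apply: (root_dvdp _ pz); rewrite dvdp_map.
by apply: (irreducible_root_dvdp irr_p px); rewrite root_expE.
Qed.

(** The rational polynomial whose roots are the [k]-th powers of the conjugates
of [x] vanishes at [x ^+ k], hence at every conjugate of it. *)
Lemma conjugate_exp_inv (C : numClosedFieldType) (x z : C) (p : {poly rat})
    (k : nat) :
  (0 < k)%N -> is_minpoly x p -> galois_conjugate (x ^+ k) z ->
  exists2 y, galois_conjugate x y & y ^+ k = z.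
Proof.
move=> k0 min_p [q [_ irr_q qx] qz]; have [mon_p irr_p px] := min_p.
have [c _ croot] := exists_poly_roots_exp (toC C) mon_p irr_p.1 k0.
have cx : root (map_poly (toC C) c) (x ^+ k) by apply/croot; exists x.
have : root (map_poly (toC C) c) z.
  apply: root_dvdp qz; rewrite dvdp_map.
  exact: irreducible_root_dvdp irr_q qx cx.
by move=> /croot [y py yz]; exists y => //; exists p.
Qed.

(** * Salem numbers *)

Lemma integralOver_exp (R K : comNzRingType) (f : {rmorphism R -> K}) (x : K)
    (k : nat) :
  integralOver f x -> integralOver f (x ^+ k).
Proof.
move=> xint; elim: k => [|k IHk]; last by rewrite exprS; apply: integral_mul.
by rewrite expr0 -(rmorph1 f); apply: integral_id.
Qed.

(** A conjugate of [theta] on the unit circle supplies one of [theta ^+ k]; it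
also supplies the minimal polynomial of [theta] as an element of [R[i]]. *)
Lemma salem_exp (R : realType) (theta : R) (k : nat) :
  (0 < k)%N -> salem theta -> salem (theta ^+ k).
Proof.
move=> k0 [int_t t1 conj_le1 [z0 [conj_z0 z0t z0_1]]].
have tk1 : 1 < theta ^+ k by rewrite expr_gt1 // ltW // (lt_trans _ t1).
have [p min_p _] := conj_z0.
split => //.
- exact: integralOver_exp.
- move=> z; rewrite rmorphXn /= => conj_z zt.
  have [y conj_y yz] := conjugate_exp_inv k0 min_p conj_z.
  rewrite -yz normrX exprn_ile1 ?normr_ge0 //; apply: conj_le1 => //.
  by apply: contraNneq zt => yt; rewrite -yz yt.
- exists (z0 ^+ k); split.
  + by rewrite rmorphXn; apply: conjugate_exp.
  + apply/eqP => /(congr1 (fun u => `|u|)) /eqP; apply/negP.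
    rewrite normrX z0_1 expr1n rmorphXn normrX.
    rewrite eq_sym gt_eqF // exprn_egt1 -?lt0n //.
    by rewrite gtr0_norm -?(rmorph0 (real_complex R))
               -?(rmorph1 (real_complex R)) ltcR // (lt_trans _ t1).
  + by rewrite normrX z0_1 expr1n.
Qed.

(** Multiplication by [x] cannot jump over an interval of ratio greater than
[x]; and since [x > 1] the powers do not stay below [a]. *)
Lemma exists_exp_between (R : archiRealFieldType) (a b x : R) :
  1 < a -> 1 < x -> x < b / a ->
  exists k, [/\ (0 < k)%N, a < x ^+ k & x ^+ k < b].
Proof.
move=> a1 x1 xba.
have a0 : 0 < a by apply: lt_trans a1.
have x0 : 0 < x by apply: lt_trans x1.
have unbounded : exists n, a < x ^+ n.
  have : (fun n => x^-1 ^+ n) @ \oo --> (0 : R).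
    by apply: cvg_expr; rewrite gtr0_norm ?invr_gt0 // invf_lt1.
  move=> /cvgr0_norm_lt /(_ a^-1); rewrite invr_gt0 => /(_ a0).
  move=> [n _ /(_ n (leqnn n))] /=; rewrite exprVn gtr0_norm.
    rewrite ltf_pV2 ?posrE ?exprn_gt0 //.
    by exists n.
  by rewrite invr_gt0 exprn_gt0.
case: (ex_minnP unbounded) => [[|n]] axn minn.
  by move: axn; rewrite expr0 ltNge ltW.
exists n.+1; split => //.
have xna : x ^+ n <= a by rewrite leNgt; apply/negP => /minn; rewrite ltnn.
rewrite exprS (le_lt_trans (y := x * a)) ?ler_pM2l //.
by rewrite -ltr_pdivlMr.
Qed.

Theorem lemma1p1 (R : realType) :
  (exists I : set R,
     [/\ open I, is_interval I, I !=set0, I `<=` `]1, +oo[ &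
         I `&` salem_numbers R = set0]) ->
  lehmer_conjecture_salem R /\
  (exists2 c : R, 1 < c & forall theta : R, salem theta -> c <= theta).
Proof.
case=> I [openI _ [x Ix] I1 I_salem].
have x1 : 1 < x by have := I1 _ Ix; rewrite /= in_itv /= andbT.
have [b xb Ixb] : exists2 b, x < b & forall y, x < y -> y < b -> I y.
  have : nbhs x I by apply: open_nbhs_nbhs.
  move=> /nbhs_ballP [e /= e0 xeI]; exists (x + e); first by rewrite ltrDl.
  move=> y xy yxe; apply: xeI.
  by rewrite /ball /= distrC gtr0_norm ?subr_gt0 // ltrBlDl.
have c1 : 1 < b / x by rewrite ltr_pdivlMr ?mul1r // (lt_trans _ x1).
have salem_ge theta : salem theta -> b / x <= theta.
  move=> salem_t; rewrite leNgt; apply/negP => tc.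
  have [_ t1 _ _] := salem_t.
  have [k [k0 xtk tkb]] := exists_exp_between x1 t1 tc.
  suff : (I `&` salem_numbers R) (theta ^+ k) by rewrite I_salem.
  by split; [exact: Ixb | exact: salem_exp].
split; last by exists (b / x).
move=> /(_ _ (lt_nbhsl c1)) [y [_ /= /salem_ge]].
by rewrite leNgt => /negP.
Qed.
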